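(* Let $\theta\in\mathbb Z$. The set $\mathfrak D_\theta$ of all e-values testing $\theta$-unimodality, i.e. of all functions $E:\mathbb Z\to[0,\infty)$ with $\mathbb E_{X\sim P}[E(X)]\le1$ for all $P\in\mathcal D_\theta$, is exactly the set of functions of the form $$n\mapsto\begin{cases}\rho_{n-\theta+1}-\rho_{n-\theta},&n>\theta,\\ \rho_1+\eta_1-1,&n=\theta,\\ \eta_{\theta-n+1}-\eta_{\theta-n},&n<\theta,\end{cases}$$ where $(\rho_n)_{n\ge1}$ and $(\eta_n)_{n\ge1}$ range over all pairs of real sequences such that $\rho_1+\eta_1\ge1$ and, for all $n\ge1$, $\rho_1\le\dots\le\rho_n\le n$ and $\eta_1\le\dots\le\eta_n\le n$.
   Context: For a probability measure $P$ on $\mathbb Z$, $f_P(n)=P(\{n\})$. $\mathcal D_\theta$ is the set of probability measures $P$ on $\mathbb Z$ such that $f_P(n-1)\le f_P(n)$ if $n\le\theta$, and $f_P(n)\ge f_P(n+1)$ if $n\ge\theta$. *)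

(* Defs.v *)
From HB Require Import structures.
From mathcomp Require Import all_boot all_order all_algebra.
From mathcomp Require Import all_classical all_reals all_analysis.
Set Implicit Arguments.
Unset Strict Implicit.
Unset Printing Implicit Defensive.
Import Order.TTheory GRing.Theory Num.Theory.
Local Open Scope classical_set_scope.
Local Open Scope ring_scope.

(* [int] carries the discrete sigma-algebra (as the library does for [nat] and
   [bool]), so that [probability int R] is the type of all probability measures
   on the integers and every function on [int] is measurable. *)
HB.instance Definition _ := isPointed.Build int 0.
HB.instance Definition _ := @isMeasurable.Build default_measure_display
  int discrete_measurable discrete_measurable0
  discrete_measurableC discrete_measurableU.

Definition pmass (R : realType) (P : probability int R) (n : int) : R :=
  fine (P [set n]).

Definition unimodal (R : realType) (theta : int) : set (probability int R) :=
  [set P | (forall n : int, n <= theta -> pmass P (n - 1) <= pmass P n) /\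
           (forall n : int, theta <= n -> pmass P (n + 1) <= pmass P n)].

(* The expectation is extended-real valued: it always exists as E is
   nonnegative, and may a priori be infinite. *)
Definition evalues (R : realType) (D : set (probability int R)) :
    set (int -> R) :=
  [set E | (forall n, 0 <= E n) /\
           (forall P, D P -> ('E_P[E] <= 1)%E)].

(* Sequences indexed by n >= 1 are functions on [nat] whose value at 0 is
   unconstrained and never used. *)
Definition admissible (R : realType) (rho : nat -> R) : Prop :=
  forall n : nat, (1 <= n)%N ->
    (forall i : nat, (1 <= i < n)%N -> rho i <= rho i.+1) /\ rho n <= n%:R.

(* [absz] is only ever applied to a positive integer here and just serves to
   convert it to [nat]. *)
Definition increment_fun (R : realType) (theta : int) (rho eta : nat -> R)
    (n : int) : R :=
  if theta < n then rho (absz (n - theta + 1)) - rho (absz (n - theta))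
  else if n == theta then rho 1%N + eta 1%N - 1
  else eta (absz (theta - n + 1)) - eta (absz (theta - n)).

(* Main.v *)
(* An e-value E satisfies E[E] <= 1 for the uniform law on any interval
   {theta - a, ..., theta + b}.  Writing S b and T a for the sums of E over the
   b points to the right and the a points to the left of theta, this says
   E theta + (S b - b) + (T a - a) <= 1.  The variables a and b are separated by
   s = sup_b (S b - b), and rho n = 1 - s + S (n - 1),
   eta n = E theta + s + T (n - 1) are as required.
   Conversely, Abel summation against the mass function, which is monotone on
   each side of theta, bounds the sum of E over {theta - N, ..., theta + N}
   weighted by P by the P-mass of that window; monotone convergence concludes. *)
From HB Require Import structures.
Require Import Defs.
From mathcomp Require Import all_boot all_order all_algebra.
From mathcomp Require Import all_classical all_reals all_analysis.
From mathcomp Require Import zify lra.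
Import Order.TTheory GRing.Theory Num.Theory.
Local Open Scope classical_set_scope.
Local Open Scope ring_scope.

(** * Integrals over the integers as limits over symmetric windows *)

Section integral_int.
Context {R : realType}.

Lemma pmass_ge0 (P : probability int R) n : 0 <= pmass P n.
Proof. exact: fine_ge0. Qed.

Lemma pmassE (P : probability int R) n : P [set n] = (pmass P n)%:E.
Proof. by rewrite /pmass fineK// fin_num_measure. Qed.

Lemma integral_singleton_int (P : probability int R) (f : int -> R) n :
  (\int[P]_(x in [set n]) (f x)%:E = (f n * pmass P n)%:E)%E.
Proof.
rewrite (eq_integral (cst (f n)%:E)); last by move=> x /[!inE] ->.
by rewrite integral_cst// EFinM -pmassE.
Qed.

Definition window (c : int) (N : nat) : set int :=
  [set n | c - N%:Z <= n <= c + N%:Z].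

Lemma windowS c N :
  window c N.+1 = window c N `|` [set c + N.+1%:Z] `|` [set c - N.+1%:Z].
Proof.
apply/seteqP; split => x /=; rewrite /window/=; last by lia.
move=> h; have [|[|]] : c - N%:Z <= x <= c + N%:Z \/ x = c + N.+1%:Z \/
  x = c - N.+1%:Z by lia.
- by left; left.
- by left; right.
- by right.
Qed.

(** The centre comes first, then the two points at each distance, so that the sum splits into its
    two sides around [c]. *)
Definition window_sum (g : int -> R) (c : int) (N : nat) : R :=
  g c + \sum_(i < N) (g (c + i.+1%:Z) + g (c - i.+1%:Z)).

Lemma integral_window (P : probability int R) (f : int -> R) c N :
  (forall n, 0 <= f n) ->
  (\int[P]_(x in window c N) (f x)%:E =
   (window_sum (fun n => f n * pmass P n) c N)%:E)%E.
Proof.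
move=> f0; elim: N => [|N IH].
  rewrite /window_sum big_ord0 addr0 -integral_singleton_int; congr integral.
  by apply/seteqP; split => x /=; rewrite /window/=; lia.
rewrite windowS ge0_integral_setU//; first last.
- by apply/disj_setPS => x [] /= [h|h] h'; move: h; rewrite /window /=; lia.
- by move=> x _; rewrite lee_fin.
rewrite ge0_integral_setU//; first last.
- by apply/disj_setPS => x [] /= + h; rewrite /window /=; lia.
- by move=> x _; rewrite lee_fin.
rewrite IH !integral_singleton_int /window_sum big_ord_recr/= -!EFinD.
by rewrite !addrA.
Qed.

Lemma bigcup_window c : \bigcup_N window c N = setT.
Proof.
apply/seteqP; split => // x _; exists (absz (x - c)) => //=.
by rewrite /window/=; lia.
Qed.

(** The windows increase to all of [int], so a bound uniform in [N] survives in the limit. *)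
Lemma integral_int_le (P : probability int R) (f : int -> R) c (M : R) :
  (forall n, 0 <= f n) ->
  (forall N, window_sum (fun n => f n * pmass P n) c N <= M) ->
  (\int[P]_x (f x)%:E <= M%:E)%E.
Proof.
move=> f0 fM; rewrite -(bigcup_window c).
have cf : (\int[P]_(x in window c N) (f x)%:E @[N --> \oo] -->
    \int[P]_(x in \bigcup_N window c N) (f x)%:E)%E.
  apply: ge0_nondecreasing_set_cvg_integral => //.
  - by move=> m n mn; apply/subsetPset => x; rewrite /window/=; lia.
  - by move=> i x _; rewrite lee_fin.
rewrite -(cvg_lim _ cf)//; apply: lime_le.
  by apply/cvg_ex; eexists; exact: cf.
by apply: nearW => N; rewrite integral_window// lee_fin.
Qed.

Lemma window_sum_pmass_le1 (P : probability int R) c N :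
  window_sum (pmass P) c N <= 1.
Proof.
have := @integral_window P (cst 1) c N (fun=> ler01).
rewrite (eq_integral (cst 1%E))// integral_cst// mul1e.
have -> : window_sum (fun n => cst 1 n * pmass P n) c N = window_sum (pmass P) c N.
  by rewrite /window_sum/= mul1r; under eq_bigr do rewrite !mul1r.
by move=> PE; rewrite -lee_fin -PE; exact: probability_le1.
Qed.

End integral_int.

(** * Uniform laws on integer intervals *)

Section uniform_range.
Context {R : realType}.
Variables (a : int) (m : nat).

(** The uniform law on {a, ..., a + m}, built from Dirac masses so that the measure structure is
    inherited and integrals reduce to finite sums. *)
Definition uniform_range : set int -> \bar R :=
  mscale (m.+1%:R^-1)%:nng (msum (fun i => \d_(a + i%:Z)) m.+1).

HB.instance Definition _ := Measure.on uniform_range.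

Lemma integral_uniform_range (f : int -> R) : (forall n, 0 <= f n) ->
  (\int[uniform_range]_x (f x)%:E =
   (m.+1%:R^-1 * \sum_(i < m.+1) f (a + i%:Z))%:E)%E.
Proof.
move=> f0; rewrite /uniform_range ge0_integral_mscale//; last first.
  by move=> x _; rewrite lee_fin.
rewrite ge0_integral_measure_sum//; last first.
  by move=> x _; rewrite lee_fin.
under eq_bigr do rewrite integral_dirac// diracT mul1e.
by rewrite sumEFin.
Qed.

Lemma uniform_range_setT : uniform_range [set: int] = 1%E.
Proof.
rewrite -[LHS]mul1e -integral_cst//.
rewrite (integral_uniform_range (cst 1)); last by move=> n; exact: ler01.
by rewrite sumr_const card_ord mulVf.
Qed.

HB.instance Definition _ :=
  Measure_isProbability.Build _ _ _ uniform_range uniform_range_setT.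

Lemma pmass_uniform_range n :
  pmass uniform_range n = m.+1%:R^-1 * (a <= n <= a + m%:Z)%R%:R :> R.
Proof.
rewrite /pmass /= /uniform_range /mscale /= /msum.
rewrite (eq_bigr (fun i : 'I_m.+1 => ((a + i%:Z)%R \in [set n])%:R%:E)).
  2: by move=> i _; exact: diracE.
rewrite sumEFin /=; congr (_ * _).
have [an|an] := boolP (a <= n <= a + m%:Z).
  (* Only the Dirac mass of index [n - a] charges [n]. *)
  have lm : (absz (n - a) < m.+1)%N by lia.
  rewrite (bigD1 (Ordinal lm))//= big1 ?addr0.
    by rewrite mem_set//=; lia.
  move=> i /eqP ni; rewrite memNset//= => ai; apply: ni; apply: val_inj => /=; lia.
rewrite big1// => i _; rewrite memNset//= => ai.
by have := ltn_ord i; move: an; lia.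
Qed.

End uniform_range.

(** * Increment functions and Abel summation *)

Section increments.
Context {R : realType}.
Implicit Types (rho eta : nat -> R) (theta : int).

Lemma increment_fun_eq theta rho eta :
  increment_fun theta rho eta theta = rho 1 + eta 1 - 1.
Proof. by rewrite /increment_fun ltxx eqxx. Qed.

Lemma increment_fun_right theta rho eta (k : nat) :
  increment_fun theta rho eta (theta + k.+1%:Z) = rho k.+2 - rho k.+1.
Proof.
rewrite /increment_fun ifT; last by lia.
by congr (rho _ - rho _); lia.
Qed.

Lemma increment_fun_left theta rho eta (k : nat) :
  increment_fun theta rho eta (theta - k.+1%:Z) = eta k.+2 - eta k.+1.
Proof.
rewrite /increment_fun ifF; last by lia.
rewrite ifF; last by lia.
by congr (eta _ - eta _); lia.
Qed.

Lemma admissible_homo rho k : admissible rho -> rho k.+1 <= rho k.+2.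
Proof. by move=> /(_ k.+2 isT)[h _]; apply: h => /=. Qed.

Lemma admissible_le rho k : admissible rho -> rho k.+1 <= k.+1%:R.
Proof. by move=> /(_ k.+1 isT)[]. Qed.

(** Partial sums of nonnegative terms are nondecreasing; this serves for the sequences built from an
    e-value. *)
Lemma admissible_sum rho (c : R) (u : nat -> R) :
  (forall k, 0 <= u k) ->
  (forall k, rho k.+1 = c + \sum_(i < k) u i) ->
  (forall k, c + \sum_(i < k) u i <= k.+1%:R) -> admissible rho.
Proof.
move=> u0 rhoE le [//|n] _; split; last by rewrite rhoE.
by move=> [//|i] _; rewrite !rhoE big_ord_recr/= addrA lerDl.
Qed.

Lemma int_eqVposneg (c n : int) :
  [\/ n = c, exists k : nat, n = c + k.+1%:Z |
      exists k : nat, n = c - k.+1%:Z].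
Proof.
have [nc|nc|->] := ltgtP n c; last by constructor 1.
- by constructor 3; exists (absz (c - n)).-1; lia.
- by constructor 2; exists (absz (n - c)).-1; lia.
Qed.

(* Abel summation: with [c i = rho i.+1 - i.+1 <= 0], the difference of the two
   sides is bounded by [p N * c N], which propagates by induction on [N]. *)
Lemma sum_increment_le rho (p : nat -> R) N : admissible rho ->
  (forall i, 0 <= p i) -> (forall i, p i.+1 <= p i) ->
  p 0%N * rho 1%N + \sum_(i < N) p i.+1 * (rho i.+2 - rho i.+1) <=
  p 0%N + \sum_(i < N) p i.+1.
Proof.
move=> rhoA p0 pN.
suff : p 0%N * rho 1%N + \sum_(i < N) p i.+1 * (rho i.+2 - rho i.+1) <=
  p 0%N + \sum_(i < N) p i.+1 + p N * (rho N.+1 - N.+1%:R).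
  move/le_trans; apply; rewrite gerDl mulr_ge0_le0// subr_le0.
  exact: admissible_le.
elim: N => [|N IH]; first by rewrite !big_ord0 !addr0; lra.
rewrite !big_ord_recr/=.
(* The induction step reduces to [(p N - p N.+1) * (rho N.+1 - N.+1%:R) <= 0], a product of factors
   of opposite signs. *)
have := admissible_le _ N rhoA; have := pN N; move: IH.
rewrite -(natr1 N.+1).
set S := \sum_(i < N) _; set T := \sum_(i < N) _.
by nra.
Qed.

End increments.

(** * The two inclusions *)

Section evalues.
Context {R : realType}.
Implicit Types (theta : int) (E : int -> R).

Lemma evalue_increment_fun theta (rho eta : nat -> R) :
  1 <= rho 1 + eta 1 -> admissible rho -> admissible eta ->
  evalues (@unimodal R theta) (increment_fun theta rho eta).
Proof.
move=> re1 rhoA etaA.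
have E0 n : 0 <= increment_fun theta rho eta n.
  have [->|[k ->]|[k ->]] := int_eqVposneg theta n.
  - by rewrite increment_fun_eq subr_ge0.
  - by rewrite increment_fun_right subr_ge0 admissible_homo.
  - by rewrite increment_fun_left subr_ge0 admissible_homo.
split=> // P [Pl Pr]; rewrite unlock; apply: (integral_int_le P _ theta) => // N.
apply: le_trans (window_sum_pmass_le1 P theta N); rewrite /window_sum.
under eq_bigr do rewrite increment_fun_right increment_fun_left
  ![_ * pmass _ _]mulrC.
rewrite increment_fun_eq !big_split/=.
(* The mass at [theta] enters both one-sided bounds; the [- 1] in the value at [theta] compensates
   for this double count. *)
have := sum_increment_le rho (fun i => pmass P (theta + i%:Z)) N rhoA
  (fun i => pmass_ge0 P _).
have := sum_increment_le eta (fun i => pmass P (theta - i%:Z)) N etaA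
  (fun i => pmass_ge0 P _).
rewrite !addr0 => H2 H1.
have : forall i : nat, pmass P (theta + i.+1%:Z) <= pmass P (theta + i%:Z).
  by move=> i; rewrite (_ : _ + i.+1%:Z = theta + i%:Z + 1); [apply: Pr|]; lia.
have : forall i : nat, pmass P (theta - i.+1%:Z) <= pmass P (theta - i%:Z).
  by move=> i; rewrite (_ : _ - i.+1%:Z = theta - i%:Z - 1); [apply: Pl|]; lia.
by move=> /H2 + /H1; lra.
Qed.

(** The mass function is a constant times the indicator of an interval that contains [theta]. *)
Lemma unimodal_uniform_range theta (a b : nat) :
  unimodal theta (uniform_range (theta - a%:Z) (a + b) : probability int R).
Proof.
split=> n hn; rewrite !pmass_uniform_range ler_wpM2l ?invr_ge0// ler_nat;
  lia.
Qed.

Lemma evalue_sum_le theta E (a b : nat) : evalues (@unimodal R theta) E ->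
  E theta + \sum_(i < b) E (theta + i.+1%:Z) + \sum_(i < a) E (theta - i.+1%:Z)
  <= (a + b).+1%:R.
Proof.
move=> [E0 /(_ _ (unimodal_uniform_range theta a b))].
rewrite unlock integral_uniform_range// lee_fin mulrC ler_pdivrMr// mul1r.
(* The range is cut into [a] points, [theta] and [b] points; the first block is reversed so as to
   run away from [theta]. *)
rewrite -addnS big_split_ord/= big_ord_recl/= (reindex_inj rev_ord_inj)/=.
rewrite addrC addn0 subrK; congr (_ + _ + _ <= _);
  apply: eq_bigr => i _; congr E; rewrite /bump/=; have := ltn_ord i; lia.
Qed.

Lemma increment_fun_evalue theta E : evalues (@unimodal R theta) E ->
  exists rho eta : nat -> R, [/\ 1 <= rho 1 + eta 1, admissible rho,
    admissible eta & E = increment_fun theta rho eta].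
Proof.
move=> EE; have [E0 _] := EE.
pose S b : R := \sum_(i < b) E (theta + i.+1%:Z).
pose T a : R := \sum_(i < a) E (theta - i.+1%:Z).
(* With [b] only on the left and [a] only on the right, any constant lying between the two sides for
   all [a] and [b] can separate them. *)
have ST a b : S b - b%:R <= a.+1%:R - E theta - T a.
  have := evalue_sum_le theta E a b EE.
  by rewrite -/(S b) -/(T a) -addSn natrD; lra.
pose s := sup (range (fun b => S b - b%:R)).
(* Index 1 gives the empty sum, so [s] cancels in [rho 1 + eta 1 = 1 + E theta]. *)
exists (fun n => 1 - s + S n.-1), (fun n => E theta + s + T n.-1); split.
- by rewrite /S /T !big_ord0; have := E0 theta; lra.
- apply: (admissible_sum _ (1 - s) (fun i => E (theta + i.+1%:Z))) => //.
  move=> k; rewrite -/(S k) -natr1.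
  suff : S k - k%:R <= s by lra.
  apply: ub_le_sup; last by exists k.
  (* [ST] at [a = 0] provides the upper bound that makes the supremum meaningful. *)
  by exists (1%:R - E theta - T 0) => _ [b _ <-]; exact: ST.
- apply: (admissible_sum _ (E theta + s) (fun i => E (theta - i.+1%:Z))) => //.
  move=> k; rewrite -/(T k).
  (* The right side of [ST] at [a = k] is free of [b], so it also bounds the supremum. *)
  suff : s <= k.+1%:R - E theta - T k by lra.
  apply: ge_sup; first by exists (S 0 - 0%:R), 0%N.
  by move=> _ [b _ <-]; exact: ST.
- apply/funext => n; have [->|[k ->]|[k ->]] := int_eqVposneg theta n.
  + by rewrite increment_fun_eq /S /T !big_ord0; lra.
  + by rewrite increment_fun_right /= /S big_ord_recr/=; lra.
  + by rewrite increment_fun_left /= /T big_ord_recr/=; lra.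
Qed.

End evalues.

Theorem theorem3p6 (R : realType) (theta : int) :
  evalues (@unimodal R theta) =
  [set E : int -> R | exists rho eta : nat -> R,
     [/\ 1 <= rho 1%N + eta 1%N, admissible rho, admissible eta &
         E = increment_fun theta rho eta]].
Proof.
apply/seteqP; split => E; first exact: increment_fun_evalue.
by case=> rho [eta [re1 rhoA etaA ->]]; exact: evalue_increment_fun.
Qed.
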